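(* (1) For $n=1$, the state $h$ on $U_1^{nc}$ given by $h(u^k)=h((u^* )^k)=\delta_{k0}$ for $k\in\mathbb N$ (the Haar/uniform probability measure on the unit circle $\{z\in\mathbb C:|z|=1\}$) is a Haar state on $U\langle 1\rangle$ for each of the five convolutions $\star_F,\star_T,\star_B,\star_M,\star_{AM}$. (2) For every $n\ge 2$, there exists no Haar state on $U\langle n\rangle$ for any of the five convolutions $\star_F,\star_T,\star_B,\star_M,\star_{AM}$.
   Context: Let $n\ge1$. $U_n^{nc}$ denotes the universal unital $*$-algebra generated by $n^2$ elements $u_{ij}$ ($1\le i,j\le n$) subject to the relations $\sum_{k=1}^n u_{ki}^*u_{kj}=\delta_{ij}1=\sum_{k=1}^n u_{ik}u_{jk}^*$ for all $i,j$ (i.e. the matrix $(u_{ij})$ is unitary in $M_n(U_n^{nc})$; the matrix $(u_{ij}^* )$ is not assumed unitary). For $n=1$, $U_1^{nc}$ is generated by a single unitary $u$, and states on it are identified with probability measures on the unit circle via $\mu(u^k)=\int z^k d\mu$, $\mu(u^{*k})=\int\bar z^kd\mu$. For unital $*$-algebras $\mathcal A,\mathcal B$, $\mathcal A\sqcup\mathcal B$ is their free product (coproduct of unital $*$-algebras, units identified); for $a\in U_n^{nc}$, $a^{(1)},a^{(2)}$ denote its copies in the first and second factor of $U_n^{nc}\sqcup U_n^{nc}$. The unital $*$-homomorphisms $\Delta:U_n^{nc}\to U_n^{nc}\sqcup U_n^{nc}$, $\delta:U_n^{nc}\to\mathbb C$, $\Sigma:U_n^{nc}\to U_n^{nc}$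 are defined by $\Delta(u_{ij})=\sum_k u_{ik}^{(1)}u_{kj}^{(2)}$, $\delta(u_{ij})=\delta_{ij}$, $\Sigma(u_{ij})=u_{ji}^*$; $U\langle n\rangle=(U_n^{nc},\Delta,\delta,\Sigma)$ is the unitary dual group. A state is a positive linear functional with value $1$ at $1$. Products of states: let $(\mathcal A_1,\phi_1),(\mathcal A_2,\phi_2)$ be unital $*$-algebras with states and with vector space decompositions $\mathcal A_i=\mathbb C1\oplus\mathcal A_i^0$, $\mathcal A_i^0$ a $*$-subalgebra. The states $\phi_1*\phi_2$ (free), $\phi_1\otimes\phi_2$ (tensor), $\phi_1\diamond\phi_2$ (boolean), $\phi_1\rhd\phi_2$ (monotone), $\phi_1\lhd\phi_2$ (anti-monotone) on $\mathcal A_1\sqcup\mathcal A_2$ are the unital linear functionals determined, for $A_1,\dots,A_m$ with $A_i\in\mathcal A_{\epsilon_i}^0$ and $\epsilon_1\ne\epsilon_2\ne\cdots\ne\epsilon_m$, respectively by: $\phi_1*\phi_2(A_1\cdots A_m)=0$ whenever $\phi_{\epsilon_i}(A_i)=0$ for all $i$; $\phi_1\otimes\phi_2(A_1\cdots A_m)=\phi_1(\prod_{i:\epsilon_i=1}A_i)\phi_2(\prod_{i:\epsilon_i=2}A_i)$; $\phi_1\diamond\phi_2(A_1\cdots A_m)=\prod_i\phi_{\epsilon_i}(A_i)$; $\phi_1\rhd\phi_2(A_1\cdots A_m)=\phi_1(\prod_{i:\epsilon_i=1}A_i)\prod_{i:\epsilon_i=2}\phi_2(A_i)$; $\phi_1\lhd\phi_2(A_1\cdots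 A_m)=\prod_{i:\epsilon_i=1}\phi_1(A_i)\,\phi_2(\prod_{i:\epsilon_i=2}A_i)$ (products in increasing order of indices). Convolutions: using the decomposition $U_n^{nc}=\mathbb C1\oplus\ker\delta$, for states $\phi,\psi$ on $U_n^{nc}$: $\phi\star_F\psi=(\phi*\psi)\circ\Delta$, $\phi\star_T\psi=(\phi\otimes\psi)\circ\Delta$, $\phi\star_B\psi=(\phi\diamond\psi)\circ\Delta$, $\phi\star_M\psi=(\phi\rhd\psi)\circ\Delta$, $\phi\star_{AM}\psi=(\phi\lhd\psi)\circ\Delta$. A Haar state for a convolution $\star$ is a state $h$ on $U_n^{nc}$ such that $\phi\star h=h=h\star\phi$ for every state $\phi$ on $U_n^{nc}$. *)

(* Defs.v *)
From HB Require Import structures.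
From mathcomp Require Import all_boot all_order all_algebra.
Set Implicit Arguments. Unset Strict Implicit. Unset Printing Implicit Defensive.
Import Order.TTheory GRing.Theory Num.Theory.
Local Open Scope ring_scope.

(* Generators of U_n^{nc}: a letter (s,i,j) stands for u_ij if s = false and *)
(* for u_ij^* if s = true.  Elements of the free *-algebra on the u_ij are    *)
(* linear combinations of words; a linear functional on U_n^{nc} is given by  *)
(* its values on words (and must vanish on the defining ideal).              *)

Definition Letter (n : nat) : Type := (bool * 'I_n * 'I_n)%type.

Section Lin.
Variable C : numClosedFieldType.

(* formal linear combinations of words over an alphabet T *)
Definition lin (T : Type) := seq (C * seq T).

Definition lone (T : Type) : lin T := [:: (1, [::])].

Definition lmul (T : Type) (x y : lin T) : lin T :=
  [seq (p.1 * q.1, p.2 ++ q.2) | p <- x, q <- y].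

Definition lprod (T : Type) (xs : seq (lin T)) : lin T := foldr (@lmul T) (lone T) xs.

Definition evl (T : Type) (f : seq T -> C) (x : lin T) : C :=
  \sum_(p <- x) p.1 * f p.2.

Definition centerize (T : Type) (c : C) (x : lin T) : lin T := x ++ [:: (- c, [::])].

Fixpoint merge (T : Type) (xs : seq (bool * lin T)) : seq (bool * lin T) :=
  match xs with
  | [::] => [::]
  | p :: t =>
      match merge t with
      | q :: r => if p.1 == q.1 then (p.1, lmul p.2 q.2) :: r else p :: q :: r
      | [::] => [:: p]
      end
  end.

Fixpoint masks (m : nat) : seq (seq bool) :=
  match m with
  | 0 => [:: [::]]
  | m'.+1 => [seq b :: s | b <- [:: true; false], s <- masks m']
  end.

(* Generic evaluation of a product functional on an alternating product      *)
(* x_1 ... x_m (x_i in the factor p.1): write x_i = c_i 1 + x_i^0 (c_i given *)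
(* by [cent]), expand, evaluate the fully centered term by [Psi] and the     *)
(* other terms (which are shorter alternating products) recursively.         *)
Fixpoint prodval (T : Type) (cent : bool -> lin T -> C)
    (Psi : seq (bool * lin T) -> C) (fuel : nat) (xs : seq (bool * lin T)) : C :=
  match fuel with
  | 0 => 0
  | f.+1 =>
      let ys := [seq (p.1, centerize (cent p.1 p.2) p.2) | p <- xs] in
      Psi ys +
      \sum_(s <- masks (size xs) | ~~ all id s)
        (\prod_(p <- mask (map negb s) xs) cent p.1 p.2) *
          prodval cent Psi f (merge (mask s ys))
  end.

Fixpoint blocks (T : Type) (w : seq (bool * T)) : seq (bool * seq T) :=
  match w with
  | [::] => [::]
  | (c, a) :: t =>
      match blocks t with
      | (c', b) :: r => if c == c' then (c, a :: b) :: r else (c, [:: a]) :: (c', b) :: r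
      | [::] => [:: (c, [:: a])]
      end
  end.

End Lin.

(* the five products; colour true = first factor, false = second factor *)
Inductive prodKind := Free | Tensor | Boolean | Monotone | AntiMonotone.

Section UnitaryDualGroup.
Variable C : numClosedFieldType.
Variable n : nat.

Definition word := seq (Letter n).
Definition cword := seq (bool * Letter n).

Definition counit (w : word) : C := \prod_(l <- w) (l.1.2 == l.2)%:R.

Definition adjw (w : word) : word := rev [seq (~~ l.1.1, l.1.2, l.2) | l <- w].

Definition is_state (f : word -> C) : Prop :=
  [/\ f [::] = 1,
      (* sum_k u_ki^* u_kj = delta_ij 1 *)
      (forall (a b : word) (i j : 'I_n),
         \sum_(k < n) f (a ++ [:: (true, k, i); (false, k, j)] ++ b)
           = (i == j)%:R * f (a ++ b)),
      (* sum_k u_ik u_jk^* = delta_ij 1 *)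
      (forall (a b : word) (i j : 'I_n),
         \sum_(k < n) f (a ++ [:: (false, i, k); (true, j, k)] ++ b)
           = (i == j)%:R * f (a ++ b)) &
      (* positivity: f(x^* x) >= 0 *)
      (forall x : lin C (Letter n),
         0 <= \sum_(p <- x) \sum_(q <- x) (p.1)^* * q.1 * f (adjw p.2 ++ q.2))].

(* Delta(u_ij) = sum_k u_ik^(1) u_kj^(2), Delta(u_ij^* ) = sum_k u_kj^(2)* u_ik^(1)* *)
Definition comult_letter (l : Letter n) : lin C (bool * Letter n) :=
  let: (s, i, j) := l in
  if s then [seq (1, [:: (false, (true, k, j)); (true, (true, i, k))]) | k <- enum 'I_n]
  else [seq (1, [:: (true, (false, i, k)); (false, (false, k, j))]) | k <- enum 'I_n].

Definition comult (w : word) : lin C (bool * Letter n) :=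
  lprod [seq comult_letter l | l <- w].

Section Products.
Variables (phi1 phi2 : word -> C).

Definition phic (c : bool) : word -> C := if c then phi1 else phi2.

Definition cent (k : prodKind) (c : bool) (x : lin C (Letter n)) : C :=
  match k with
  | Free => evl (phic c) x
  | _ => evl counit x
  end.

Definition prod_of (c : bool) (ys : seq (bool * lin C (Letter n))) :=
  lprod [seq p.2 | p <- ys & p.1 == c].

(* values on alternating products of centered elements *)
Definition Psi (k : prodKind) (ys : seq (bool * lin C (Letter n))) : C :=
  match k with
  | Free => if ys is [::] then 1 else 0
  | Tensor => evl phi1 (prod_of true ys) * evl phi2 (prod_of false ys)
  | Boolean => \prod_(p <- ys) evl (phic p.1) p.2
  | Monotone => evl phi1 (prod_of true ys) *
                \prod_(p <- ys | ~~ p.1) evl phi2 p.2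
  | AntiMonotone => (\prod_(p <- ys | p.1) evl phi1 p.2) *
                    evl phi2 (prod_of false ys)
  end.

(* the product state on U_n^{nc} \sqcup U_n^{nc}, on (two-coloured) words *)
Definition prod_state (k : prodKind) (w : cword) : C :=
  let xs := [seq (b.1, [:: (1 : C, b.2)]) | b <- blocks w] in
  prodval (cent k) (Psi k) (size xs).+1 xs.

End Products.

Definition conv (k : prodKind) (phi psi : word -> C) : word -> C :=
  fun w => evl (prod_state phi psi k) (comult w).

Definition is_haar (k : prodKind) (h : word -> C) : Prop :=
  is_state h /\
  forall phi, is_state phi ->
    (forall w, conv k phi h w = h w) /\ (forall w, conv k h phi w = h w).

End UnitaryDualGroup.

(* n = 1: h(u^k) = h(u^*^k) = delta_k0, i.e. on words h(w) = [#u = #u^*] *)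
Definition haar1 (C : numClosedFieldType) (w : word 1) : C :=
  (count (fun l : Letter 1 => ~~ l.1.1) w == count (fun l : Letter 1 => l.1.1) w)%:R.

(* Main.v *)
Require Import Defs.
From HB Require Import structures.
From mathcomp Require Import all_boot all_order all_algebra.
From mathcomp Require Import ring zify.
Import Order.TTheory GRing.Theory Num.Theory.
Local Open Scope ring_scope.
Set Implicit Arguments. Unset Strict Implicit. Unset Printing Implicit Defensive.

(* Each product state is the vacuum functional of an explicit representation of
   the free product: on the tensor product of the two algebras for the tensor,
   boolean, monotone and anti-monotone products, and on the space of reduced
   alternating tensors for the free product.

   For [n = 1] the comultiplication sends [u ^ d] to [(u1 u2) ^ d], so it suffices
   to see that [(u1 u2) ^ d] has vacuum expectation [0] for [d <> 0]. In the free
   case this is a grading argument, the Haar factor being homogeneous. In the other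
   cases one of the two halves, positive or negative, of the grading by the degree in
   the Haar factor is stable under the letters that occur, and the vacuum vanishes there.

   For [n >= 2] let [u_ij] act as the matrix unit [e_ji] tensored with the bilateral
   shift, and let [phi_a] be the vector state at [e_a (x) delta_0]: all its first
   moments vanish. On [u_00^* u_00] the convolution of [phi_a] with any state [h],
   in the order depending on the product, has value [1] if [a = 0] and [0] otherwise,
   so [h] cannot absorb both [phi_0] and [phi_1]. *)

(** * Evaluating functionals on formal linear combinations *)

Section Evaluation.
Variables (C : numClosedFieldType) (T : Type).
Implicit Types (x y : lin C T) (f : seq T -> C).

Lemma evl_word f w : evl f [:: (1, w)] = f w.
Proof. by rewrite /evl big_seq1 mul1r. Qed.

Lemma eq_evl f g x : f =1 g -> evl f x = evl g x.
Proof. by move=> fg; apply: eq_bigr => p _; rewrite fg. Qed.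

Lemma evl_lmul f x y :
  evl f (lmul x y) = evl (fun u => evl (fun v => f (u ++ v)) y) x.
Proof.
rewrite /evl /lmul big_allpairs_dep; apply: eq_bigr => p _.
by rewrite mulr_sumr; apply: eq_bigr => q _; rewrite mulrA.
Qed.

Lemma evl_lone f : evl f (lone C T) = f [::].
Proof. exact: evl_word. Qed.

Lemma evl_centerize f c x : evl f (centerize c x) = evl f x - c * f [::].
Proof. by rewrite /evl /centerize big_cat big_seq1 /= mulNr. Qed.

Lemma evl_addf f g x : evl (fun w => f w + g w) x = evl f x + evl g x.
Proof. by rewrite -big_split; apply: eq_bigr => p _; rewrite mulrDr. Qed.

Lemma evl_mull c f x : evl (fun w => c * f w) x = c * evl f x.
Proof. by rewrite mulr_sumr; apply: eq_bigr => p _; rewrite mulrCA. Qed.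

Lemma evl_mulr c f x : evl (fun w => f w * c) x = evl f x * c.
Proof. by rewrite mulr_suml; apply: eq_bigr => p _; rewrite mulrA. Qed.

Lemma evl_sum (I : Type) (r : seq I) (a : I -> C) (F : I -> seq T -> C) x :
  evl (fun w => \sum_(i <- r) a i * F i w) x = \sum_(i <- r) a i * evl (F i) x.
Proof.
elim: r => [|i r IH].
  by rewrite big_nil /evl big1 // => p _; rewrite big_nil mulr0.
rewrite big_cons -IH -evl_mull -evl_addf.
by apply: eq_evl => w; rewrite big_cons.
Qed.

End Evaluation.

Lemma evl_exchange (C : numClosedFieldType) (T T' : Type)
  (F : seq T -> seq T' -> C) (x : lin C T) (y : lin C T') :
  evl (fun u => evl (F u) y) x = evl (fun v => evl (F^~ v) x) y.
Proof.
exact: esym (evl_sum x (fun p => p.1) (fun p => F p.2) y).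
Qed.


(** Inductions on products below run over the reversed list of factors, so the last factor has to be
    peeled off. *)
Lemma evl_lprod_rcons (C : numClosedFieldType) (T : Type) (f : seq T -> C)
    (xs : seq (lin C T)) (x : lin C T) :
  evl f (lprod (rcons xs x)) = evl (fun u => evl (fun v => f (v ++ u)) (lprod xs)) x.
Proof.
elim: xs f => [|y xs IH] f /=.
  rewrite evl_lmul; apply: eq_evl => u.
  by rewrite !evl_lone cats0.
rewrite evl_lmul.
under eq_evl do rewrite IH.
rewrite evl_exchange; apply: eq_evl => u.
rewrite evl_lmul; apply: eq_evl => v; apply: eq_evl => w.
by rewrite catA.
Qed.

(** * Alternating products and the recursion [prodval] *)

Section ColouredProducts.
Variables (C : numClosedFieldType) (T : Type).
Implicit Types (x : lin C T) (xs ys : seq (bool * lin C T)).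

Definition colour (c : bool) (w : seq T) : seq (bool * T) := [seq (c, l) | l <- w].

Definition colour_lin (c : bool) x : lin C (bool * T) :=
  [seq (p.1, colour c p.2) | p <- x].

Definition cprod xs : lin C (bool * T) := lprod [seq colour_lin p.1 p.2 | p <- xs].

Implicit Type F : seq (bool * T) -> C.

Lemma evl_colour_lin F c x :
  evl F (colour_lin c x) = evl (fun w => F (colour c w)) x.
Proof. by rewrite /evl /colour_lin big_map. Qed.

Lemma evl_cprod_nil F : evl F (cprod [::]) = F [::].
Proof. exact: evl_lone. Qed.

Lemma evl_cprod_cons F c x xs :
  evl F (cprod ((c, x) :: xs)) =
  evl (fun u => evl (fun v => F (colour c u ++ v)) (cprod xs)) x.
Proof. by rewrite /cprod /= evl_lmul evl_colour_lin. Qed.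

Lemma evl_cprod_rcons F c x xs :
  evl F (cprod (rcons xs (c, x))) =
  evl (fun u => evl (fun v => F (v ++ colour c u)) (cprod xs)) x.
Proof. by rewrite /cprod map_rcons evl_lprod_rcons evl_colour_lin. Qed.

Definition hdneq (U : Type) (c : bool) (s : seq (bool * U)) : bool :=
  if s is (d, _) :: _ then d != c else true.

Fixpoint alternating (U : Type) (s : seq (bool * U)) : bool :=
  if s is (c, _) :: t then hdneq c t && alternating t else true.

Lemma alternating_rev (U : Type) (s : seq (bool * U)) :
  alternating (rev s) = alternating s.
Proof.
have altE (r : seq (bool * U)) : alternating r = sorted (fun p q => q.1 != p.1) r.
  case: r => //= -[c a] r; elim: r c a => //= -[d b] r IH c a.
  by rewrite (IH d b).
rewrite !altE rev_sorted; apply: eq_sorted => p q; by rewrite /= eq_sym.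
Qed.

Lemma evl_merge F xs : evl F (cprod (Defs.merge xs)) = evl F (cprod xs).
Proof.
elim: xs F => //= -[c x] xs IH F.
rewrite evl_cprod_cons.
under [RHS]eq_evl do rewrite -IH.
case: (Defs.merge xs) => [|[d y] ys]; first by rewrite evl_cprod_cons.
rewrite [(c, x).1]/= [(d, y).1]/=; case: eqP => [<-|_]; last by rewrite evl_cprod_cons.
rewrite evl_cprod_cons /= evl_lmul; apply: eq_evl => u.
rewrite evl_cprod_cons; apply: eq_evl => v; apply: eq_evl => w.
by rewrite /colour map_cat catA.
Qed.

Lemma alternating_merge xs : alternating (Defs.merge xs).
Proof.
elim: xs => //= -[c x] xs; case: (Defs.merge xs) => [|[d y] ys] //=.
by case: eqP => [<-|/eqP cd] //= /andP[-> ->]; rewrite eq_sym cd.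
Qed.

Lemma size_merge xs : (size (Defs.merge xs) <= size xs)%N.
Proof.
elim: xs => //= -[c x] xs; case: (Defs.merge xs) => [|[d y] ys] //= IH.
by case: eqP => _ //=; apply: leq_trans IH _.
Qed.

Lemma size_masks m s : s \in masks m -> size s = m.
Proof.
elim: m s => [|m IH] s /=; first by rewrite inE => /eqP ->.
by rewrite cats0 mem_cat => /orP[] /mapP[t /IH <- ->].
Qed.

(** Isolates the fully centred term, which [prodval] writes apart from its sum. *)
Lemma masks_all_id (K : seq bool -> C) m :
  \sum_(s <- masks m | all id s) K s = K (nseq m true).
Proof.
elim: m K => [|m IH] K /=; first by rewrite big_cons big_nil addr0.
rewrite cats0 big_cat !big_map /= IH.
by rewrite [X in _ + X]big_pred0 // addr0.
Qed.

Section Expansion.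
Variable chi : bool -> seq T -> C.
Hypothesis chi1 : forall c, chi c [::] = 1.

Let cen (c : bool) x := evl (chi c) x.
Let centered xs := [seq (p.1, centerize (cen p.1 p.2) p.2) | p <- xs].

(** Each factor is its centred part plus the scalar [cen]; the mask records where the centred part
    is taken. *)
Lemma evl_cprod_expand F xs :
  evl F (cprod xs) =
  \sum_(s <- masks (size xs)) (\prod_(p <- mask (map negb s) xs) cen p.1 p.2) *
     evl F (cprod (mask s (centered xs))).
Proof.
elim: xs F => [|[c x] xs IH] F /=.
  by rewrite big_seq1 big_nil mul1r.
rewrite cats0 big_cat !big_map /=.
transitivity (evl (fun u => evl (fun v => F (colour c u ++ v)) (cprod xs))
                (centerize (cen c x) x) + cen c x * evl F (cprod xs)).
  by rewrite evl_cprod_cons evl_centerize /= subrK.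
congr (_ + _).
  under eq_evl do rewrite IH.
  rewrite evl_sum; apply: eq_bigr => s _.
  by rewrite evl_cprod_cons.
by rewrite IH mulr_sumr; apply: eq_bigr => s _; rewrite big_cons mulrA.
Qed.

(* The recursion of [prodval] is the expansion above: it computes any functional
   whose values on alternating products of centred elements are given by [Psi]. *)
Lemma prodvalE (Psi : seq (bool * lin C T) -> C) F :
  (forall ys, alternating ys -> all (fun p => cen p.1 p.2 == 0) ys ->
     evl F (cprod ys) = Psi ys) ->
  forall fuel xs, alternating xs -> (size xs < fuel)%N ->
  prodval cen Psi fuel xs = evl F (cprod xs).
Proof.
move=> FPsi; elim=> // fuel IH xs alt_xs /= lt_xs.
rewrite evl_cprod_expand [RHS](bigID (fun s => all id s)) /= masks_all_id.
congr (_ + _).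
  rewrite map_nseq mask_false big_nil mul1r mask_true ?size_map // FPsi //.
    elim: xs alt_xs {lt_xs} => //= -[c x] xs IHx /= /andP[hd /IHx ->].
    by case: xs hd {IHx} => [|[d y] xs] //= ->.
  rewrite all_map; elim: xs {alt_xs lt_xs} => //= p xs ->.
  by rewrite /cen evl_centerize chi1 mulr1 subrr eqxx.
(* The other masks drop at least one factor and [merge] never lengthens, so the remaining fuel
   suffices. *)
rewrite big_seq_cond [RHS]big_seq_cond; apply: eq_bigr => s /andP[s_in nall].
rewrite IH ?evl_merge ?alternating_merge //.
apply: leq_ltn_trans (size_merge _) _; rewrite size_mask; last first.
  by rewrite size_map (size_masks s_in).
rewrite ltnS in lt_xs; apply: leq_trans lt_xs.
rewrite -(size_masks s_in) ltn_neqAle count_size andbT.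
by move: nall; rewrite all_count.
Qed.

End Expansion.

Lemma blocks_alternating (w : seq (bool * T)) : alternating (blocks w).
Proof.
elim: w => //= -[c a] w; case: (blocks w) => [|[d b] r] //=.
by case: eqP => [<-|/eqP cd] //= /andP[-> ->]; rewrite eq_sym cd.
Qed.

Lemma flatten_blocks (w : seq (bool * T)) :
  flatten [seq colour b.1 b.2 | b <- blocks w] = w.
Proof.
elim: w => //= -[c a] w; case: (blocks w) => [|[d b] r] /= <- //.
by case: eqP => [<-|].
Qed.

Lemma evl_cprod_words F (bs : seq (bool * seq T)) :
  evl F (cprod [seq (b.1, [:: (1, b.2)]) | b <- bs]) =
  F (flatten [seq colour b.1 b.2 | b <- bs]).
Proof.
elim: bs F => [|[c b] bs IH] F /=; first by rewrite evl_cprod_nil.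
by rewrite evl_cprod_cons evl_word IH.
Qed.

End ColouredProducts.

(** * The four products centred by the counit *)

Section CounitProducts.
Variables (C : numClosedFieldType) (n : nat) (I : Type).
Variables (push : Letter n -> I -> I) (i0 : I) (m : bool -> I -> C) (t : bool -> bool).
Hypothesis m1 : forall c, m c i0 = 1.

Definition pushw (w : word n) (i : I) : I := foldr push i w.

(* With [P] the rank one projection [v |-> phi v *: 1], a letter [x] of the first
   factor acts on the tensor product of the two algebras by [x (x) 1], or by
   [x (x) P + counit x (1 - 1 (x) P)] when [t] tells that the elements of the second
   factor are to be evaluated separately; likewise for the second factor. The
   functionals [G] below are acted upon from the right. *)
Definition counit_step (b : bool) (mu : I -> C) (l : Letter n) (G : I -> I -> C) (i j : I) : C :=
  if b then (l.1.2 == l.2)%:R * (G i j - G i i0 * mu j) + G (push l i) i0 * mu j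
  else G (push l i) j.

Definition counit_act (G : I -> I -> C) (a : bool * Letter n) : I -> I -> C :=
  if a.1 then counit_step (t false) (m false) a.2 G
  else fun i j => counit_step (t true) (m true) a.2 (fun j i => G i j) j i.

Definition counit_acts (w : cword n) (G : I -> I -> C) : I -> I -> C := foldl counit_act G w.

Definition counit_vac (i j : I) : C := m true i * m false j.

Lemma eq_counit_acts w G G' : G =2 G' -> counit_acts w G =2 counit_acts w G'.
Proof.
elim: w G G' => //= -[c l] w IH G G' GG'; apply: IH => i j.
by rewrite /counit_act /counit_step; case: c => /=; case: ifP => _; rewrite !GG'.
Qed.

Lemma counit_acts_cat u v G : counit_acts (u ++ v) G = counit_acts v (counit_acts u G).
Proof. exact: foldl_cat. Qed.

(** As [mu i0 = 1], the slice at [i0] evolves by [push] alone, while the complement is scaled by the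
    multiplicative counit; hence letters compose to the same formula. *)
Lemma counit_step_word b mu w G i j : mu i0 = 1 ->
  foldl (fun G l => counit_step b mu l G) G w i j =
  if b then counit C w * (G i j - G i i0 * mu j) + G (pushw w i) i0 * mu j
  else G (pushw w i) j.
Proof.
move=> mu1; elim: w G => [|l w IH] G /=.
  by rewrite /counit big_nil; case: b; ring.
rewrite IH /counit_step; case: b {IH} => //.
by rewrite /counit big_cons mu1; ring.
Qed.

Lemma counit_acts_true w G i j :
  counit_acts (colour true w) G i j =
  if t false then
    counit C w * (G i j - G i i0 * m false j) + G (pushw w i) i0 * m false j
  else G (pushw w i) j.
Proof.
rewrite -counit_step_word // /counit_acts /colour.
by elim: w G => //= l w IH G; rewrite IH.
Qed.

Lemma counit_acts_false w G i j :
  counit_acts (colour false w) G i j =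
  if t true then
    counit C w * (G i j - G i0 j * m true i) + G i0 (pushw w j) * m true i
  else G i (pushw w j).
Proof.
rewrite -(counit_step_word _ _ (fun j i => G i j)) // /counit_acts /colour.
by elim: w G => //= l w IH G; rewrite IH.
Qed.

Lemma counit_acts_cancel c l l' G i j :
  cancel (push l') (push l) -> counit C [:: l; l'] = 1 ->
  counit_acts [:: (c, l); (c, l')] G i j = G i j.
Proof.
move=> ll' d1; case: c.
  by rewrite (counit_acts_true [:: l; l']) d1 /= ll'; case: ifP => _ //; ring.
by rewrite (counit_acts_false [:: l; l']) d1 /= ll'; case: ifP => _ //; ring.
Qed.

(* [counit_sep c r] is the [c]-component of the reversed product [r] of centred elements. *)
Fixpoint counit_sep (c : bool) (r : seq (bool * lin C (Letter n))) (i : I) : C :=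
  match r with
  | [::] => m c i
  | (d, x) :: r' =>
      if d == c then evl (fun w => counit_sep c r' (pushw w i)) x
      else if t c then m c i * counit_sep c r' i0 else counit_sep c r' i
  end.

(** Peel off the last factor: the part of its action scaled by the counit vanishes by centring, and
    the rest feeds the coordinate of its colour, resetting the other one to [i0] if that one is
    evaluated separately. *)
Lemma counit_acts_cprod r i j :
  all (fun p => evl (counit C (n := n)) p.2 == 0) r ->
  evl (fun w => counit_acts w counit_vac i j) (cprod (rev r)) =
  counit_sep true r i * counit_sep false r j.
Proof.
elim: r i j => [|[c x] r IH] i j /=; first by rewrite evl_cprod_nil.
case/andP=> /eqP x0 /IH{}IH.
rewrite rev_cons evl_cprod_rcons.
under eq_evl => u do under eq_evl => v do rewrite counit_acts_cat.
case: c => /=; [under eq_evl => u do under eq_evl => v do rewrite counit_acts_true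
               |under eq_evl => u do under eq_evl => v do rewrite counit_acts_false].
- case: (t false).
    under eq_evl => u do rewrite evl_addf evl_mull !evl_mulr IH.
    by rewrite evl_addf !evl_mulr x0 mul0r add0r mulrAC -mulrA.
  under eq_evl => u do rewrite IH.
  by rewrite evl_mulr.
- case: (t true).
    under eq_evl => u do rewrite evl_addf evl_mull !evl_mulr IH.
    by rewrite evl_addf !evl_mulr x0 mul0r add0r evl_mull mulrC mulrA.
  under eq_evl => u do rewrite IH.
  by rewrite evl_mull.
Qed.


Lemma counit_sep_joint c r i : ~~ t c ->
  counit_sep c r i = evl (fun w => m c (pushw w i)) (prod_of c (rev r)).
Proof.
move=> tc; elim: r i => [|[d x] r IH] i /=; first by rewrite evl_lone.
rewrite /prod_of rev_cons filter_rcons /=; case: eqP => _; last first.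
  by rewrite (negPf tc) IH.
rewrite map_rcons evl_lprod_rcons; apply: eq_evl => u.
by rewrite IH; apply: eq_evl => v; rewrite /pushw foldr_cat.
Qed.

Lemma counit_sep_hdneq c r i : t c -> hdneq c r -> counit_sep c r i = m c i * counit_sep c r i0.
Proof.
move=> tc; case: r => [|[d x] r] /=; first by rewrite m1 mulr1.
by move/negPf => ->; rewrite tc m1 mul1r.
Qed.

(** Alternation puts a factor of the other colour between two of colour [c]; it resets the
    coordinate to [i0], so the values multiply. *)
Lemma counit_sep_separate c r : t c -> alternating r ->
  counit_sep c r i0 = \prod_(p <- r | p.1 == c) evl (fun w => m c (pushw w i0)) p.2.
Proof.
move=> tc; elim: r => [|[d x] r IH] /=; first by rewrite big_nil m1.
rewrite big_cons /= => /andP[hd /IH{}IH]; case: eqP => [dc|_]; last first.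
  by rewrite tc m1 mul1r.
rewrite -IH -evl_mulr; apply: eq_evl => w.
by rewrite counit_sep_hdneq // -dc.
Qed.

End CounitProducts.

(** The value [false] groups [Free] with [Tensor] and [AntiMonotone] in the case split of
    [no_haar]. *)
Definition separate (k : prodKind) (c : bool) : bool :=
  match k with
  | Boolean => true | Monotone => ~~ c | AntiMonotone => c | _ => false
  end.

Lemma counit_nil (C : numClosedFieldType) n : @counit C n [::] = 1.
Proof. exact: big_nil. Qed.

(** A word is the alternating product of its blocks, so [prodvalE] applies to it. *)
Lemma prod_state_unique (C : numClosedFieldType) (n : nat) (phi1 phi2 : word n -> C)
    (k : prodKind) (chi : bool -> word n -> C) (F : cword n -> C) :
  (forall c, chi c [::] = 1) ->
  cent phi1 phi2 k = (fun c x => evl (chi c) x) ->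
  (forall ys, alternating ys -> all (fun p => evl (chi p.1) p.2 == 0) ys ->
     evl F (cprod ys) = Psi phi1 phi2 k ys) ->
  prod_state phi1 phi2 k =1 F.
Proof.
move=> chi1 centE FPsi w; rewrite /prod_state centE.
rewrite (prodvalE chi1 FPsi) ?evl_cprod_words ?flatten_blocks //.
have := blocks_alternating w.
elim: (blocks w) => //= -[c b] bs IH /andP[hd /IH ->].
by case: bs hd {IH} => [|[d b'] bs] //= ->.
Qed.

Theorem prod_state_counit (C : numClosedFieldType) (n : nat) (I : Type)
    (push : Letter n -> I -> I) (i0 : I) (m : bool -> I -> C)
    (phi1 phi2 : word n -> C) (k : prodKind) :
  k <> Free -> (forall c, m c i0 = 1) ->
  (forall c w, phic phi1 phi2 c w = m c (pushw push w i0)) ->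
  prod_state phi1 phi2 k =1 fun w => counit_acts push i0 m (separate k) w (counit_vac m) i0 i0.
Proof.
move=> kF m1 phiE.
apply: (prod_state_unique (chi := fun=> counit C (n := n))) => [_||ys alt_ys ys0].
- exact: counit_nil.
- by case: k kF.
rewrite -[ys]revK counit_acts_cprod ?all_rev // .
have joint c : ~~ separate k c ->
    counit_sep push i0 m (separate k) c (rev ys) i0 = evl (phic phi1 phi2 c) (prod_of c ys).
  by move=> tc; rewrite counit_sep_joint // revK; apply: eq_evl => w; rewrite phiE.
have sep c : separate k c -> counit_sep push i0 m (separate k) c (rev ys) i0 =
    \prod_(p <- ys | p.1 == c) evl (phic phi1 phi2 c) p.2.
  move=> tc; rewrite counit_sep_separate ?alternating_rev // big_rev.
  by apply: eq_bigr => p _; apply: eq_evl => w; rewrite phiE.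
rewrite revK; case: k kF joint sep => //= _ joint sep.
- by rewrite !joint.
- rewrite !sep // [RHS](bigID (fun p => p.1 == true)) /=.
  congr (_ * _); first by apply: eq_bigr => p /eqP ->.
  by apply: eq_big => p; case: p.1.
- rewrite (joint true) // (sep false) //; congr (_ * _).
  by apply: eq_bigl => p; case: p.1.
- rewrite (joint false) // (sep true) //; congr (_ * _).
  by apply: eq_bigl => p; case: p.1.
Qed.

(** * The free product on reduced alternating tensors *)

Section FreeProduct.
Variables (C : numClosedFieldType) (n : nat) (I : eqType).
Variables (push : Letter n -> I -> I) (i0 : I) (m : bool -> I -> C).
Hypothesis m1 : forall c, m c i0 = 1.
Implicit Types (G : seq (bool * I) -> C) (b : seq (bool * I)).

(* [(c1, i1) ... (cr, ir)] stands for the alternating product of the centred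
   elements [i - m c i]; the factor is zero when [i = i0] is the unit. *)
Definition free_ins G (c : bool) (i : I) b : C :=
  (if i == i0 then 0 else G ((c, i) :: b)) + m c i * G b.

(** A leg [(d, i)] means [i] minus the scalar [m d i], so a letter of its colour gives [push i]
    minus [m d i] times the letter applied to the unit. *)
Definition free_act G (a : bool * Letter n) b : C :=
  let e := free_ins G a.1 (push a.2 i0) in
  match b with
  | (d, i) :: b' =>
      if d == a.1 then free_ins G a.1 (push a.2 i) b' - m a.1 i * e b' else e b
  | [::] => e [::]
  end.

Definition free_acts (w : cword n) G : seq (bool * I) -> C := foldl free_act G w.

Definition free_vac b : C := (nilp b)%:R.

Lemma free_acts_cat u v G : free_acts (u ++ v) G = free_acts v (free_acts u G).
Proof. exact: foldl_cat. Qed.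

Lemma free_act_hdneq c l G b : hdneq c b -> free_act G (c, l) b = free_ins G c (push l i0) b.
Proof. by case: b => [|[d i] b] //=; rewrite /free_act /= => /negPf ->. Qed.

(** The subtraction in [free_act] undoes the centring made by the previous letter, so the word acts
    as one insertion. *)
Lemma free_acts_word c w G b :
  hdneq c b -> free_acts (colour c w) G b = free_ins G c (pushw push w i0) b.
Proof.
move=> hd; elim: w G => [|l w IH] G /=.
  by rewrite /free_ins eqxx m1 add0r mul1r.
rewrite [LHS]IH {1}/free_ins (free_act_hdneq _ _ hd); case: eqP => [->|_].
  by rewrite m1 add0r mul1r.
by rewrite /free_act /= eqxx subrK.
Qed.

(** Each factor has zero scalar part and a colour other than that of the top leg, so it only adds a
    leg; the vacuum kills nonempty sequences. *)
Lemma free_acts_cprod r b : alternating r ->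
  all (fun p => evl (fun w => m p.1 (pushw push w i0)) p.2 == 0) r ->
  (if r is (c, _) :: _ then hdneq c b else true) -> ~~ (nilp r && nilp b) ->
  evl (fun w => free_acts w free_vac b) (cprod (rev r)) = 0.
Proof.
elim: r b => [|[c x] r IH] b /=.
  by move=> _ _ _; rewrite evl_cprod_nil /= /free_vac => /negPf ->.
case/andP=> hdr alt_r /andP[/eqP x0 r0] hdb _.
rewrite rev_cons evl_cprod_rcons.
under eq_evl => u do under eq_evl => v do rewrite free_acts_cat free_acts_word //.
under eq_evl => u do rewrite evl_addf evl_mull.
rewrite evl_addf evl_mulr x0 mul0r addr0.
rewrite /evl big1 // => p _; case: eqP => _.
  by rewrite big1 ?mulr0 // => q _; rewrite mulr0.
rewrite [X in _ * X]IH ?mulr0 ?andbF //.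
by case: r hdr {IH alt_r r0} => [|[d y] r] //=; rewrite eq_sym.
Qed.

Fixpoint reduced b : bool :=
  if b is (c, i) :: b' then [&& i != i0, hdneq c b' & reduced b'] else true.

(** Inverse letters are shown to cancel on reduced sequences, so congruence is needed there; the
    action at a reduced sequence consults no others. *)
Lemma eq_free_act G G' a : 
  (forall b, reduced b -> G b = G' b) ->
  forall b, reduced b -> free_act G a b = free_act G' a b.
Proof.
move=> GG' b red.
have finsE i b' : reduced b' -> hdneq a.1 b' -> free_ins G a.1 i b' = free_ins G' a.1 i b'.
  move=> rb hd; rewrite /free_ins (GG' b') //.
  by case: eqP => // /eqP i0P; rewrite GG' //= i0P hd.
rewrite /free_act; case: b red => [|[d i] b] /=; first by move=> _; rewrite finsE.
case/and3P=> i0P hd red; case: eqP => [da|/eqP da].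
  by rewrite !finsE // -da.
by rewrite finsE //= i0P hd red.
Qed.

Lemma eq_free_acts w G G' : 
  (forall b, reduced b -> G b = G' b) ->
  forall b, reduced b -> free_acts w G b = free_acts w G' b.
Proof. by elim: w G G' => //= a w IH G G' GG'; apply/IH/eq_free_act. Qed.

Lemma free_act_cancel c l l' G b : cancel (push l') (push l) -> reduced b ->
  free_acts [:: (c, l); (c, l')] G b = G b.
Proof.
move=> ll' red.
have [hd|] := boolP (hdneq c b).
  rewrite (free_acts_word [:: l; l']) //= ll' /free_ins eqxx m1 add0r mul1r //.
case: b red => [|[d i] b] //= /and3P[i0P hd red]; rewrite negbK => /eqP dc.
subst d; rewrite /= {1}/free_act /= eqxx.
have step j : j <> i0 -> free_act G (c, l) ((c, j) :: b)
    = free_ins G c (push l j) b - m c j * free_ins G c (push l i0) b.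
  by move=> _; rewrite /free_act /= eqxx.
have finsE j : free_ins (free_act G (c, l)) c j b = free_ins G c (push l j) b.
  rewrite {1}/free_ins (free_act_hdneq _ _ hd); case: eqP => [->|/step ->].
    by rewrite m1 add0r mul1r.
  by rewrite subrK.
rewrite !finsE !ll' /free_ins eqxx m1 (negPf i0P); ring.
Qed.

End FreeProduct.

Theorem prod_state_free (C : numClosedFieldType) (n : nat) (I : eqType)
    (push : Letter n -> I -> I) (i0 : I) (m : bool -> I -> C)
    (phi1 phi2 : word n -> C) :
  (forall c, m c i0 = 1) ->
  (forall c w, phic phi1 phi2 c w = m c (pushw push w i0)) ->
  prod_state phi1 phi2 Free =1 fun w => free_acts push i0 m w (@free_vac C I) [::].
Proof.
move=> m1 phiE.
apply: (prod_state_unique (chi := phic phi1 phi2)) => // [c|ys alt_ys ys0].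
  by rewrite phiE m1.
case: ys alt_ys ys0 => [|y ys] alt_ys ys0; first exact: evl_cprod_nil.
transitivity (0 : C) => //; 
have : ~~ nilp (y :: ys) by [].
move: (y :: ys) alt_ys ys0 => {y}{}ys; rewrite -[ys]revK; move: (rev ys) => r.
rewrite alternating_rev all_rev /nilp size_rev => alt_r r0 r_nil.
apply: free_acts_cprod => //; last by rewrite andbT.
  apply: sub_all r0 => p /eqP p0.
  by rewrite -[X in _ == X]p0; apply/eqP/eq_evl => w; rewrite phiE.
by case: (r) => [|[]].
Qed.

(** * Vector states of the matrix shift *)

Lemma gram_key_ge0 (C : numClosedFieldType) (K : eqType) (x : seq (C * option K)) :
  0 <= \sum_(p <- x) \sum_(q <- x) p.1^* * q.1 * ((q.2 == p.2) && p.2)%:R.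
Proof.
pose ks := undup (pmap snd x).
(* Zero vectors [None] drop out, and each key contributes the squared modulus of its total
   coefficient. *)
suff -> : \sum_(p <- x) \sum_(q <- x) p.1^* * q.1 * ((q.2 == p.2) && p.2)%:R =
    \sum_(k <- ks) `|\sum_(p <- x | p.2 == Some k) p.1| ^+ 2.
  by apply: sumr_ge0 => k _; rewrite exprn_ge0.
transitivity (\sum_(k <- ks) \sum_(p <- x) \sum_(q <- x)
    p.1^* * q.1 * ((p.2 == Some k) && (q.2 == Some k))%:R); last first.
  apply: eq_bigr => k _; rewrite normCK rmorph_sum mulrC /= mulr_suml [RHS]big_mkcond.
  apply: eq_bigr => p _; case: eqP => _ /=; last by rewrite big1 // => q _; rewrite mulr0.
  rewrite mulr_sumr [RHS]big_mkcond; apply: eq_bigr => q _.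
  by case: eqP; rewrite ?mulr1 ?mulr0.
rewrite [RHS]exchange_big big_seq [RHS]big_seq; apply: eq_bigr => p px.
rewrite [RHS]exchange_big; apply: eq_bigr => q _; rewrite -mulr_sumr; congr (_ * _).
case: p px => c [k|] px /=; last by rewrite andbF big1 // => k _.
rewrite andbT (bigD1_seq k) ?undup_uniq //=; last first.
  by rewrite mem_undup mem_pmap; apply/mapP; exists (c, Some k).
rewrite eqxx big1 ?addr0 // => k' /negPf kk'.
by rewrite [Some k == _]eq_sym [_ == Some k]kk'.
Qed.

Section ShiftState.
Variables (C : numClosedFieldType) (n : nat).
Implicit Types (l : Letter n) (w : word n) (a : 'I_n) (z : 'I_n * int).

(* [u_ij] acts on the basis of [C^n (x) l^2(Z)] as the matrix unit [e_ji] tensored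
   with the bilateral shift; [None] is the zero vector. *)
Definition hop l z : option ('I_n * int) :=
  let: (s, i, j) := l in
  if s then (if z.1 == j then Some (i, z.2 - 1) else None)
  else (if z.1 == i then Some (j, z.2 + 1) else None).

Definition hops w (o : option ('I_n * int)) := foldr (fun l => obind (hop l)) o w.

Definition shift_state a w : C := (hops w (Some (a, 0)) == Some (a, 0))%:R.

Lemma hops_cat u v o : hops (u ++ v) o = hops u (hops v o).
Proof. exact: foldr_cat. Qed.

Lemma hops_None w : hops w None = None.
Proof. by elim: w => //= l w ->. Qed.

Lemma hop_adj l z z' :
  (hop (~~ l.1.1, l.1.2, l.2) z == Some z') = (hop l z' == Some z).
Proof.
case: l z z' => -[s i j] [x d] [x' d'] /=.
have SomeE (o o' : 'I_n * int) :
    (Some o == Some o' :> option ('I_n * int)) = (o.1 == o'.1) && (o.2 == o'.2).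
  by case: o o' => ? ? [].
case: s => /=.
  have [->|/negPf xi] := eqVneq x i; have [->|/negPf xj] := eqVneq x' j;
    rewrite ?SomeE /= ?eqxx ?[j == _]eq_sym ?[i == _]eq_sym ?xi ?xj //=.
  by rewrite subr_eq eq_sym.
have [->|/negPf xi] := eqVneq x' i; have [->|/negPf xj] := eqVneq x j;
  rewrite ?SomeE /= ?eqxx ?[j == _]eq_sym ?[i == _]eq_sym ?xi ?xj //=.
by rewrite subr_eq eq_sym.
Qed.

Lemma hops_adjw w z z' : (hops (adjw w) (Some z) == Some z') = (hops w (Some z') == Some z).
Proof.
elim: w z => [|l w IH] z /=; first by rewrite eq_sym.
have -> : adjw (l :: w) = adjw w ++ [:: (~~ l.1.1, l.1.2, l.2)].
  by rewrite /adjw /= rev_cons cats1.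
rewrite hops_cat; have := hop_adj l z.
change (hops [:: _] _) with (hop (~~ l.1.1, l.1.2, l.2) z).
case: (hop (_, _) z) => [y|] hopE.
  rewrite [LHS]IH; case: (hops w _) => [y'|] //=.
  by rewrite -[RHS]hopE eq_sym.
rewrite hops_None; case: (hops w _) => [y'|] //=.
by rewrite -[RHS]hopE.
Qed.

(** In each relation only the [k] matching the current basis index survives. By [hops_adjw], the
    form in the positivity axiom is a Gram matrix of vectors that are zero or in the basis. *)
Lemma shift_state_is_state a : is_state (shift_state a).
Proof.
split.
- by rewrite /shift_state eqxx.
- move=> u v i j; rewrite /shift_state.
  under eq_bigr => k _ do rewrite !hops_cat /=.
  rewrite hops_cat; case: (hops v _) => [[x d]|] /=; last first.
    by rewrite hops_None mulr0 big1.
  rewrite (bigD1 x) //= eqxx /= big1 => [|k /negPf kx]; last first.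
    by rewrite [x == k]eq_sym kx hops_None.
  rewrite addr0 [i == j]eq_sym; case: (j == i) => /=; last by rewrite hops_None mul0r.
  by rewrite addrK mul1r.
- move=> u v i j; rewrite /shift_state.
  under eq_bigr => k _ do rewrite !hops_cat /=.
  rewrite hops_cat; case: (hops v _) => [[x d]|] /=; last first.
    by rewrite hops_None mulr0 big1.
  rewrite (bigD1 x) //= eqxx /= big1 => [|k /negPf kx]; last first.
    by rewrite [x == k]eq_sym kx hops_None.
  rewrite addr0 [i == j]eq_sym; case: (j == i) => /=; last by rewrite hops_None mul0r.
  by rewrite subrK mul1r.
- move=> x; pose y := [seq (p.1, hops p.2 (Some (a, 0))) | p <- x].
  have := gram_key_ge0 y; rewrite big_map.
  under eq_bigr => p _ do rewrite big_map.
  congr (_ <= _); apply: eq_bigr => p _; apply: eq_bigr => q _; congr (_ * _).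
  rewrite /shift_state hops_cat /=; case: (hops q.2 _) => [z|] /=.
    by rewrite hops_adjw eq_sym; case: (hops p.2 _) => [z'|] //=; rewrite andbT.
  by rewrite hops_None; case: hops.
Qed.

End ShiftState.

(** * Nonexistence of a Haar state for [n >= 2] *)

Section ThreeBlocks.
Variables (C : numClosedFieldType) (n : nat) (phi1 phi2 : word n -> C).
Hypotheses (phi11 : phi1 [::] = 1) (phi21 : phi2 [::] = 1).
Variables b l l' b' : Letter n.

Let w : cword n := [:: (false, b); (true, l); (true, l'); (false, b')].

Let phic1 c : phic phi1 phi2 c [::] = 1.
Proof. by case: c. Qed.

(** Stacking letters with [cons] on the empty word realises arbitrary functionals. *)
Let phicE c v : phic phi1 phi2 c v = phic phi1 phi2 c (pushw cons v [::]).
Proof. by congr (phic _ _ _ _); elim: v => //= a v {1}->. Qed.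

(** The only block of the first factor contributes a scalar, after which the outer letters meet
    inside [phi2]. *)
Lemma prod_state_three_blocks_joint k : ~~ separate k false ->
  prod_state phi1 phi2 k w = phi1 [:: l; l'] * phi2 [:: b; b'].
Proof.
case: k => // _.
- rewrite (@prod_state_free _ _ (seq (bool * 'I_n * 'I_n)) _ _ _ _ _ phic1 phicE).
  rewrite /free_acts /=; do 4!rewrite /free_act /= /free_ins /=.
  rewrite /free_vac /=; ring.
- rewrite (prod_state_counit _ phic1 phicE) //.
- rewrite (prod_state_counit _ phic1 phicE) //=.
  rewrite /counit_acts /counit_act /= /counit_step /counit_vac /= /counit_step /= phi11 phi21; ring.
Qed.
(** The centred part of the middle block keeps [b] and [b'] apart and contributes zero; its counit
    part lets them meet. *)
Lemma prod_state_three_blocks_separate k :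
  separate k false -> phi2 [:: b] = 0 -> phi2 [:: b'] = 0 ->
  prod_state phi1 phi2 k w = counit C [:: l; l'] * phi2 [:: b; b'].
Proof.
move=> kF b0 b'0; rewrite (prod_state_counit _ phic1 phicE); last by case: k kF.
rewrite /counit !big_cons big_nil.
case: k kF => // _.
all: rewrite /counit_acts /counit_act /= /counit_step /counit_vac /= /counit_step /=.
all: by rewrite phi11 phi21 ?b0 ?b'0; ring.
Qed.

End ThreeBlocks.

Lemma evl_comult_pair (C : numClosedFieldType) n (F : cword n -> C) (i j i' j' : 'I_n) :
  evl F (comult C [:: (true, i, j); (false, i', j')]) =
  \sum_p \sum_q F [:: (false, (true, p, j)); (true, (true, i, p));
                      (true, (false, i', q)); (false, (false, q, j'))].
Proof.
rewrite /comult /= evl_lmul /evl /= big_map big_enum /=; apply: eq_bigr => p _.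
rewrite mul1r /lmul big_allpairs_dep big_map big_enum /=; apply: eq_bigr => q _.
by rewrite big_seq1 /= !mul1r.
Qed.

Lemma no_haar (C : numClosedFieldType) n k (h : word n -> C) :
  (2 <= n)%N -> ~ is_haar k h.
Proof.
case: n h => [|[|n]] // h _ [[h1 hrel _ _] hH].
pose i0 : 'I_n.+2 := ord0; pose w0 := [:: (true, i0, i0); (false, i0, i0)].
suff hE a : h w0 = (i0 == a)%:R.
  by have := hE ord_max; rewrite (hE i0) eqxx => /eqP; rewrite oner_eq0.
have [phiH1 phiH2] := hH _ (shift_state_is_state C a).
have phi1 : shift_state C a [::] = 1 by rewrite /shift_state eqxx.
(* A single letter moves the integer coordinate, whence the zero. *)
have phi0 s i j : shift_state C a [:: (s, i, j)] = 0.
  by rewrite /shift_state /=; case: s; case: ifP => // _;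
    apply/eqP; rewrite pnatr_eq0 eqb0; apply/eqP => -[].
have phi2 i j i' j' : shift_state C a [:: (true, i, j); (false, i', j')] =
    ((i == a) && (i' == a) && (j == j'))%:R.
  rewrite /shift_state /=; rewrite (eq_sym a); case: (i' == a) => /=; last by rewrite andbF.
  rewrite (eq_sym j'); case: (j == j') => /=; last by rewrite andbF.
  by rewrite addrK !andbT [RHS](_ : _ = ((i, 0 : int) == (a, 0))%:R) // xpair_eqE eqxx andbT.
have [kF|kF] := boolP (separate k false).
(* With the shift state second, the counit keeps only [p = q = i0]. *)
- rewrite -phiH2 /conv evl_comult_pair.
  under eq_bigr => p _ do under eq_bigr => q _
    do rewrite prod_state_three_blocks_separate // phi2.
  rewrite (bigD1 i0) //= (bigD1 i0) //= !big1; last 2 first.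
  - move=> p /negPf p0; rewrite big1 // => q _.
    by rewrite /counit big_cons /= [i0 == p]eq_sym p0 !mul0r.
  - move=> q /negPf q0.
    by rewrite /counit !big_cons /= [i0 == q]eq_sym q0 mul0r mulr0 mul0r.
  by rewrite /counit !big_cons big_nil /= !eqxx !addr0 andbT andbb !mul1r.
(* With the shift state first, only [p = q] survives, and unitarity of the column [i0] makes the
   values of [h] sum to [1]. *)
- rewrite -phiH1 /conv evl_comult_pair.
  under eq_bigr => p _ do under eq_bigr => q _
    do rewrite prod_state_three_blocks_joint // phi2 andbb.
  have := hrel [::] [::] i0 i0; rewrite eqxx /= h1 mulr1 -[true%:R]/(1 : C) => sum1.
  rewrite -[RHS]mulr1 -[X in _ = _ * X]sum1 mulr_sumr; apply: eq_bigr => p _.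
  rewrite (bigD1 p) //= eqxx andbT big1 ?addr0 // => q /negPf qp.
  by rewrite [p == q]eq_sym qp andbF mul0r.
Qed.

(** * Words in a single unitary *)

Definition letter1 (s : bool) : Letter 1 := (s, ord0, ord0).

Lemma letter1E (l : Letter 1) : l = letter1 l.1.1.
Proof. by case: l => -[s i j]; rewrite (ord1 i) (ord1 j). Qed.

Definition shift1 (l : Letter 1) (d : int) : int := if l.1.1 then d - 1 else d + 1.

Definition degree (w : word 1) : int := pushw shift1 w 0.

Lemma degree_cons l w : degree (l :: w) = shift1 l (degree w).
Proof. by []. Qed.

Definition cancels (C : Type) (f : word 1 -> C) : Prop :=
  forall u l l' v, l.1.1 != l'.1.1 -> f (u ++ [:: l, l' & v]) = f (u ++ v).

Lemma shift1K (l l' : Letter 1) : l.1.1 != l'.1.1 -> cancel (shift1 l') (shift1 l).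
Proof.
by rewrite /shift1; case: l.1.1; case: l'.1.1 => // _ d; rewrite ?addrK ?subrK.
Qed.

Lemma degree_cancels : cancels degree.
Proof.
by move=> u l l' v ll'; rewrite /degree /pushw !foldr_cat /= (shift1K ll').
Qed.

Lemma degree_nseq k s : degree (nseq k (letter1 s)) = if s then - k%:Z else k%:Z.
Proof.
elim: k => [|k IH]; first by case: s.
by rewrite (degree_cons (letter1 s) (nseq k _)) IH /shift1 /=; case: s {IH}; lia.
Qed.

(** Read the word with a power of one letter carried on its left: the next letter extends that power
    or cancels against it. *)
Lemma cancels_ext (C : Type) (f g : word 1 -> C) : cancels f -> cancels g ->
  (forall k s, f (nseq k (letter1 s)) = g (nseq k (letter1 s))) -> f =1 g.
Proof.
move=> fc gc fg w; suff E k s : f (nseq k (letter1 s) ++ w) = g (nseq k (letter1 s) ++ w).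
  exact: (E 0%N true).
elim: w k s => [|l w IH] k s; first by rewrite cats0.
have [ls|ls] := eqVneq s l.1.1.
  have -> : nseq k (letter1 s) ++ l :: w = nseq k.+1 (letter1 s) ++ w.
    by rewrite -(addn1 k) nseqD -catA {1}[l]letter1E -ls.
  exact: IH.
case: k => [|k]; first by have := IH 1%N l.1.1; rewrite /= -letter1E.
have -> : nseq k.+1 (letter1 s) ++ l :: w = nseq k (letter1 s) ++ [:: letter1 s, l & w].
  by rewrite -(addn1 k) nseqD -catA.
by rewrite fc // gc.
Qed.

Definition power (d : int) : word 1 :=
  match d with Posz k => nseq k (letter1 false) | Negz k => nseq k.+1 (letter1 true) end.

Lemma degree_power d : degree (power d) = d.
Proof. by case: d => k; rewrite degree_nseq // NegzE. Qed.

Section OneDimensional.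
Variable C : numClosedFieldType.
Implicit Types (phi : word 1 -> C).

Lemma state_cancels phi : is_state phi -> cancels phi.
Proof.
case=> _ r1 r2 _ u l l' v; rewrite (letter1E l) (letter1E l') /=.
case: l.1.1 l'.1.1 => -[] // _.
  by have := r1 u v ord0 ord0; rewrite big_ord1 mul1r.
by have := r2 u v ord0 ord0; rewrite big_ord1 mul1r.
Qed.

(** Lets the integers serve as the space on which both factors act. *)
Lemma state_degree phi : is_state phi -> forall w, phi w = phi (power (degree w)).
Proof.
move=> /state_cancels phic w.
apply: (cancels_ext phic (g := fun w => phi (power (degree w)))).
  by move=> u l l' v ll'; rewrite degree_cancels.
by move=> [|k] [] //; rewrite degree_nseq // -NegzE.
Qed.

Lemma haar1E w : haar1 C w = (degree w == 0)%:R.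
Proof.
rewrite /haar1; congr (nat_of_bool _)%:R.
suff -> : degree w = (count (fun l : Letter 1 => ~~ l.1.1) w)%:Z
                   - (count (fun l : Letter 1 => l.1.1) w)%:Z by lia.
elim: w => // l w IH; rewrite degree_cons IH /shift1 /=.
by case: l.1.1 => /=; lia.
Qed.

(** Supplies the positivity of the Haar functional. *)
Lemma haar1_shift_state : haar1 C =1 shift_state C ord0.
Proof.
move=> w; rewrite haar1E /shift_state.
suff -> : hops w (Some (ord0, 0)) = Some (ord0, degree w) by [].
elim: w => //= l w ->; rewrite {1}[l]letter1E /= /degree /= /shift1.
by case: l.1.1.
Qed.

Lemma eq_is_state n (f g : word n -> C) : f =1 g -> is_state f -> is_state g.
Proof.
move=> fg [f1 r1 r2 pos]; split=> [|a b i j|a b i j|x].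
- by rewrite -fg.
- by rewrite -fg -r1; apply: eq_bigr => k _; rewrite fg.
- by rewrite -fg -r2; apply: eq_bigr => k _; rewrite fg.
- have := pos x; congr (_ <= _); apply: eq_bigr => p _.
  by apply: eq_bigr => q _; rewrite fg.
Qed.

Lemma haar1_is_state : is_state (haar1 C).
Proof.
by apply: eq_is_state (shift_state_is_state C ord0) => w; rewrite haar1_shift_state.
Qed.

(** The comultiplication on letters: [u] goes to [u1 u2], and [u^*] to [u2^* u1^*]. *)
Definition double (l : Letter 1) : cword 1 := [:: (~~ l.1.1, l); (l.1.1, l)].

Definition doubles (w : word 1) : cword 1 := flatten (map double w).

Lemma evl_comult1 (F : cword 1 -> C) w : evl F (comult C w) = F (doubles w).
Proof.
elim: w F => [|l w IH] F; first exact: evl_lone.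
rewrite /comult /= evl_lmul.
have enum1 : enum 'I_1 = [:: ord0].
  by apply: (inj_map val_inj); rewrite val_enum_ord.
have -> : comult_letter C l = [:: (1, double l)].
  by rewrite [l]letter1E /letter1 /= enum1; case: l.1.1.
by rewrite evl_word [LHS]IH.
Qed.

Lemma doubles_cat u v : doubles (u ++ v) = doubles u ++ doubles v.
Proof. by rewrite /doubles map_cat flatten_cat. Qed.

Lemma doubles_nseqS k s :
  doubles (nseq k.+1 (letter1 s)) = doubles (nseq k (letter1 s)) ++ double (letter1 s).
Proof.
by rewrite -(addn1 k) nseqD doubles_cat.
Qed.

(** In the image of two inverse letters the inner pair shares a colour; once it cancels, the outer
    pair is adjacent and cancels too. *)
Lemma doubles_haar (F : cword 1 -> C) : F [::] = 1 ->
  (forall u c l l' v, l.1.1 != l'.1.1 -> F (u ++ [:: (c, l), (c, l') & v]) = F (u ++ v)) ->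
  (forall k s, F (doubles (nseq k.+1 (letter1 s))) = 0) ->
  forall w, F (doubles w) = haar1 C w.
Proof.
move=> F1 Fc F0; apply: cancels_ext.
- move=> u l l' v ll'; rewrite doubles_cat.
  have -> : doubles [:: l, l' & v] = (~~ l.1.1, l) :: [:: (l.1.1, l), (l.1.1, l')
                                        & (~~ l.1.1, l') :: doubles v].
    by rewrite /doubles /double /=; move: ll'; case: l.1.1; case: l'.1.1.
  by rewrite -cat_rcons Fc // cat_rcons Fc // doubles_cat.
- by move=> u l l' v ll'; rewrite !haar1E degree_cancels.
- move=> [|k] s; first by rewrite F1 haar1E.
  rewrite F0 haar1E degree_nseq; by case: s.
Qed.

End OneDimensional.

(** * Convolution with the Haar state for [n = 1] *)

Section HaarFactor.
Variables (C : numClosedFieldType) (m : bool -> int -> C) (c0 : bool).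
Hypothesis m1 : forall c, m c 0 = 1.
Hypothesis m0 : forall d, d != 0 -> m c0 d = 0.

Section Counit.
Variable t : bool -> bool.
Local Notation act := (counit_act shift1 0 m t).
Local Notation acts := (counit_acts shift1 0 m t).

Definition vanishes (Z : pred int) (G : int -> int -> C) : Prop :=
  forall i j, Z (if c0 then i else j) -> G i j = 0.

(** The Haar coordinate is kept, shifted or reset to [0]; if [0] lies outside [Z], the reset term
    carries a factor [m c0] that vanishes on [Z]. *)
Lemma act_vanishes (Z : pred int) G c (l : Letter 1) :
  (forall d, Z d -> Z (shift1 l d)) ->
  vanishes Z G -> vanishes Z (act G (c, l)).
Proof.
rewrite /vanishes /counit_act /counit_step => Zl GZ i j.
have mZ : ~~ Z 0 -> forall d, Z d -> m c0 d = 0.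
  by move=> nZ0 d Zd; apply: m0; apply: contraNneq nZ0 => <-.
case: c0 GZ mZ => GZ mZ Zd.
- have [G1 G2] : (forall x, G i x = 0) /\ (forall x, G (shift1 l i) x = 0).
    by split=> x; apply: GZ => //; apply: Zl.
  case: c => /=; case: ifP => _; rewrite ?G1 ?G2 //; first by ring.
  have [Z0|/mZ/(_ _ Zd) ->] := boolP (Z 0); last by ring.
  by rewrite !GZ //; ring.
- have [G1 G2] : (forall x, G x j = 0) /\ (forall x, G x (shift1 l j) = 0).
    by split=> x; apply: GZ => //; apply: Zl.
  case: c => /=; case: ifP => _; rewrite ?G1 ?G2 //; last by ring.
  have [Z0|/mZ/(_ _ Zd) ->] := boolP (Z 0); last by ring.
  by rewrite !GZ //; ring.
Qed.

Lemma acts_doubles_vanishes (Z : pred int) G k s :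
  (forall d, Z d -> Z (shift1 (letter1 s) d)) ->
  vanishes Z G -> vanishes Z (acts (doubles (nseq k (letter1 s))) G).
Proof.
move=> Zl; elim: k G => // k IH G GZ; apply: (IH (act (act G _) _)).
by do 2!apply: act_vanishes => //.
Qed.

Lemma acts_doubles_haar k s :
  acts (doubles (nseq k.+1 (letter1 s))) (counit_vac m) 0 0 = 0.
Proof.
(* Here the Haar letter is the last of each double: at the end it moves [0] into the open half-line
   [Z], where the functional vanishes. *)
have [c0s|c0s] := eqVneq c0 s.
  pose Z d := if s then (d <= -1 :> int) else (1 <= d).
  have Zl d : Z d -> Z (shift1 (letter1 s) d).
    by rewrite /Z /shift1 /=; case: (s); lia.
  have Z0 : Z (shift1 (letter1 s) 0) by rewrite /Z /shift1 /=; case: (s).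
  have vac : vanishes Z (counit_vac m).
    move=> i j Zd; rewrite /counit_vac.
    have : m c0 (if c0 then i else j) = 0.
      by apply: m0; apply: contraTneq Zd => ->; rewrite /Z; case: (s).
    by case: (c0) => ->; rewrite ?mul0r ?mulr0.
  rewrite doubles_nseqS counit_acts_cat; set G0 := acts (doubles _) _.
  change (act (act G0 (~~ s, letter1 s)) (s, letter1 s) 0 0 = 0).
  set G := act G0 _.
  have GZ : vanishes Z G.
    by apply: act_vanishes => //; apply: acts_doubles_vanishes.
  move: Z0 GZ; rewrite /vanishes /counit_act /counit_step /= -c0s => Z0 GZ.
  case: c0 Z0 GZ => Z0 GZ.
    by rewrite (GZ _ 0 Z0); case: ifP => _; rewrite ?m1; ring.
  by rewrite (GZ 0 _ Z0); case: ifP => _; rewrite ?m1; ring.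
(* Here the Haar letter comes first in each double, so after one such letter the functional vanishes
   on the closed half-line, at [0] included. *)
pose Z d := if s then (d <= 0 :> int) else (0 <= d).
have Zl d : Z d -> Z (shift1 (letter1 s) d).
  by rewrite /Z /shift1 /=; case: (s); lia.
have Z0 : Z 0 by rewrite /Z; case: (s).
have ZN d : Z d -> m c0 (shift1 (letter1 s) d) = 0.
  by move=> Zd; apply: m0; move: Zd; rewrite /Z /shift1 /=; case: (s); lia.
suff GZ : vanishes Z (acts (doubles (nseq k.+1 (letter1 s))) (counit_vac m)).
  by apply: GZ; case: (c0).
apply: (@acts_doubles_vanishes Z (act (act (counit_vac m) _) _)) => //.
apply: act_vanishes => //.
rewrite /vanishes /counit_act /counit_step /counit_vac /=.
have -> : ~~ s = c0 by move: c0s; case: (c0); case: (s).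
move=> i j; case: c0 ZN => ZN /ZN Zd; case: ifP => _; rewrite ?Zd ?m1; ring.
Qed.

End Counit.

(* Since the Haar state is homogeneous, so is its free product with any state. *)
Definition bdegree (b : seq (bool * int)) : int :=
  \sum_(p <- b | p.1 == c0) p.2.

Definition cdegree (w : cword 1) : int :=
  \sum_(p <- w | p.1 == c0) shift1 p.2 0.

(** In the Haar colour the scalar part of a nonzero [i] is zero, so only the term carrying the full
    degree remains. *)
Lemma free_ins_degree G d c i b :
  (forall b, bdegree b != d -> G b = 0) ->
  (if c == c0 then i else 0) + bdegree b != d -> free_ins 0 m G c i b = 0.
Proof.
move=> Gd; rewrite /free_ins; have [->|/negPf cc0] := eqVneq c c0 => bd; last first.
  rewrite add0r in bd; rewrite (Gd b) // mulr0 addr0; case: eqP => // _.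
  by apply: Gd; rewrite /bdegree big_cons cc0.
have [i0|i0] := eqVneq i 0.
  by rewrite add0r (Gd b) ?mulr0 // -[bdegree b]add0r -i0.
by rewrite m0 // mul0r addr0 Gd // /bdegree big_cons eqxx.
Qed.

Lemma free_acts_degree G d w :
  (forall b, bdegree b != d -> G b = 0) ->
  forall b, bdegree b + cdegree w != d -> free_acts shift1 0 m w G b = 0.
Proof.
elim: w G d => [|[c l] w IH] G d Gd b.
  by rewrite /cdegree big_nil addr0; apply: Gd.
rewrite /cdegree big_cons -/(cdegree w) /=.
set e := if c == c0 then shift1 l 0 + cdegree w else cdegree w => bd.
apply: (IH _ (d - (if c == c0 then shift1 l 0 else 0))); last first.
  by move: bd; rewrite /e; case: (c == c0); lia.
move=> {bd e} {}b bd.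
have shiftE i : shift1 l i = i + shift1 l 0 by rewrite /shift1; case: ifP; lia.
rewrite /free_act /=; case: b bd => [|[c' i] b] bd.
  by apply: free_ins_degree Gd _; move: bd; rewrite /bdegree big_nil; case: (c == c0); lia.
case: eqP => [c'c|_]; last first.
  by apply: free_ins_degree Gd _; move: bd; case: (c == c0); lia.
move: bd; rewrite /bdegree big_cons /= c'c -/(bdegree b) => bd.
rewrite (free_ins_degree Gd) ?sub0r; last first.
  by rewrite shiftE; move: bd; case: (c == c0); lia.
(* The subtracted term is left; its coefficient vanishes for a Haar leg with [i] nonzero, and
   otherwise the leg carries no degree. *)
have [i0|i0] := eqVneq i 0.
  by rewrite (free_ins_degree Gd) ?mulr0 ?oppr0 //; move: bd; rewrite i0; case: (c == c0); lia.
have [->|/negPf cc0] := eqVneq c c0; first by rewrite m0 // mul0r oppr0.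
by rewrite (free_ins_degree Gd) ?mulr0 ?oppr0 //; move: bd; rewrite cc0; lia.
Qed.

Lemma cdegree_doubles w : cdegree (doubles w) = degree w.
Proof.
elim: w => [|l w IH]; first by rewrite /cdegree big_nil.
rewrite degree_cons -IH /cdegree /doubles /= !big_cons /=.
by rewrite /shift1; case: l.1.1; case: c0 => /=; lia.
Qed.

(** The vacuum lives in degree [0], while the word has degree [k + 1] up to sign. *)
Lemma free_acts_doubles_haar k s :
  free_acts shift1 0 m (doubles (nseq k.+1 (letter1 s))) (@free_vac C _) [::] = 0.
Proof.
apply: (@free_acts_degree _ 0); last first.
  by rewrite cdegree_doubles degree_nseq /bdegree big_nil; case: s; lia.
by case=> [|p b] //; rewrite /bdegree big_nil eqxx.
Qed.

End HaarFactor.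

Lemma conv_haar1 (C : numClosedFieldType) k c0 (phi1 phi2 : word 1 -> C) :
  is_state phi1 -> is_state phi2 -> phic phi1 phi2 c0 = haar1 C ->
  conv k phi1 phi2 =1 haar1 C.
Proof.
move=> st1 st2 phi_h w; pose m c d := phic phi1 phi2 c (power d).
have m1 c : m c 0 = 1 by rewrite /m /phic; case: c; [case: st1|case: st2].
have m0 d : d != 0 -> m c0 d = 0.
  by rewrite /m phi_h haar1E degree_power => /negPf ->.
have mE c v : phic phi1 phi2 c v = m c (pushw shift1 v 0).
  by case: c; rewrite /m /phic; apply: state_degree.
rewrite /conv evl_comult1.
have [kF|kF] : k = Free \/ k <> Free by case: k; [left|right..].
  rewrite kF (prod_state_free m1 mE).
  apply: (doubles_haar (F := fun w => free_acts shift1 0 m w (@free_vac C _) [::])) => //.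
    move=> u c l l' v ll'; rewrite !free_acts_cat -cat1s -[_ :: v]cat1s catA free_acts_cat.
    by apply: eq_free_acts => // b; apply: free_act_cancel => //; apply: shift1K.
  by move=> k' s; apply: free_acts_doubles_haar m0 _ _.
rewrite (prod_state_counit kF m1 mE).
apply: (doubles_haar (F := fun w => counit_acts shift1 0 m (separate k) w (counit_vac m) 0 0)).
- by rewrite /= /counit_vac !m1 mulr1.
- move=> u c l l' v ll'; rewrite !counit_acts_cat -cat1s -[_ :: v]cat1s catA counit_acts_cat.
  apply: eq_counit_acts => i j; apply: counit_acts_cancel => //; first exact: shift1K.
  by rewrite /counit !big_cons big_nil (letter1E l) (letter1E l') !mul1r.
- by move=> k' s; apply: acts_doubles_haar m1 m0 _ _ _.
Qed.

Theorem mainTheorem1 (C : numClosedFieldType) :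
  (forall k : prodKind, is_haar k (haar1 C)) /\
  (forall n : nat, (2 <= n)%N ->
     forall k : prodKind, ~ exists h : word n -> C, is_haar k h).
Proof.
split=> [k|n n2 k [h]]; last exact: no_haar.
split=> [|phi st]; first exact: haar1_is_state.
have st1 := haar1_is_state C.
by split; [apply: (@conv_haar1 _ k false)|apply: (@conv_haar1 _ k true)].
Qed.
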